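(* Let $G$ be a compact abelian group with discrete dual group $\Gamma$, let $N \in \mathbb{N}$ and $E \subset \Gamma$. The following are equivalent: (1) $E$ is $N$-PR; (2) whenever $\gamma_1, \dots, \gamma_n \in E$ are distinct and $\prod_{i=1}^n \gamma_i^{m_i} = 1$ for some integers $m_1,\dots,m_n \in \mathbb{Z}$, then $N$ divides $m_i$ for all $i$.
   Context: Characters are written multiplicatively; $\mathbb{Z}_N$ is identified with the $N$-th roots of unity in the unit circle $\mathbb{T}$. A subset $E \subset \Gamma$ is $N$-PR if for every function $\varphi: E \to \mathbb{Z}_N$ there exists $x \in G$ with $\varphi(\gamma) = \gamma(x)$ for all $\gamma \in E$. *)

(* Defs.v *)
From HB Require Import structures.
From mathcomp Require Import all_boot all_order all_algebra.
From mathcomp Require Import all_classical all_reals topology normedtype tvs.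
From mathcomp Require Import complex.
Export numFieldTopology.Exports.
Import Order.TTheory GRing.Theory Num.Theory.

Set Implicit Arguments.
Unset Strict Implicit.
Unset Printing Implicit Defensive.

Local Open Scope ring_scope.
Local Open Scope classical_set_scope.

(* The complex numbers over a real type R, with their usual (norm) topology.
   The unit circle T is [set z | `|z| = 1]. *)
Definition CC (R : realType) : numClosedFieldType := R[i].

Definition is_character (R : realType) (G : topologicalZmodType)
    (g : G -> CC R) : Prop :=
  [/\ continuous g,
      (forall x, `|g x| = 1) &
      (forall x y, g (x + y) = g x * g y)].

Definition dual_group (R : realType) (G : topologicalZmodType) : set (G -> CC R) :=
  [set g | is_character g].

Definition Z_N (R : realType) (N : nat) : set (CC R) := [set z | z ^+ N = 1].

(* E is N-PR: every function phi : E -> Z_N is of the form gamma |-> gamma(x).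
   (phi is given as a total function whose values off E are irrelevant.) *)
Definition N_PR (R : realType) (G : topologicalZmodType) (N : nat)
    (E : set (G -> CC R)) : Prop :=
  forall phi : (G -> CC R) -> CC R,
    (forall gamma, E gamma -> @Z_N R N (phi gamma)) ->
    exists x : G, forall gamma, E gamma -> phi gamma = gamma x.

Definition relations_divisible (R : realType) (G : topologicalZmodType) (N : nat)
    (E : set (G -> CC R)) : Prop :=
  forall (n : nat) (gamma : 'I_n -> (G -> CC R)) (m : 'I_n -> int),
    injective gamma ->
    (forall i, E (gamma i)) ->
    (forall x : G, \prod_(i < n) (gamma i x) ^ (m i) = 1) ->
    forall i, (N%:Z %| m i)%Z.

(* Main.v *)
(* Divisibility of relations from N-PR: let phi be a primitive N-th root of unity at one gamma_i and
   1 elsewhere. For the converse, compactness of G reduces to finitely many gamma_i, with targets z_i.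
   Put F = prod_i (1 + gamma_i / z_i), so that |F| <= 2 ^ n, with equality exactly where
   gamma_i(x) = z_i for all i. If two monomials in the gamma_i coincide on G then by hypothesis so do
   the corresponding monomials in the z_i, so no cancellation occurs when F ^ k is expanded and terms
   with equal characters are collected. Fourier coefficients being bounded by the sup norm (obtained by
   averaging translates, without Haar measure), 2 ^ (n k) <= (k + 1) ^ n * sup |F| ^ k for all k. Hence
   sup |F| = 2 ^ n, and the maximum is attained. This is Bohr's proof of Kronecker's theorem. *)

Require Import Defs.
From HB Require Import structures.
From mathcomp Require Import all_boot all_order all_algebra.
From mathcomp Require Import all_classical all_reals topology normedtype tvs.
From mathcomp Require Import complex.
From mathcomp Require Import ring finmap.
From mathcomp Require Import cyclic separable cyclotomic derive.
Import Order.TTheory GRing.Theory Num.Theory.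
Local Open Scope ring_scope.
Local Open Scope classical_set_scope.

(** * Growth of powers *)

Lemma CC_bound (R : realType) (x : CC R) : exists n : nat, `|x| < n.+1%:R.
Proof.
exists (Num.bound (complex.Re `|x|)).
have e : `|x| = (complex.Re `|x|)%:C%C by rewrite RRe_real // normr_real.
rewrite [X in X < _]e.
rewrite -(rmorph_nat (real_complex R)) ltcR.
apply: (lt_le_trans (archi_boundP _)); last by rewrite ler_nat.
by rewrite -(@lecR R) -e rmorph0 normr_ge0.
Qed.

Lemma bernoulli (K : numDomainType) (h : K) n : 0 <= h -> 1 + n%:R * h <= (1 + h) ^+ n.
Proof.
move=> h0; elim: n => [|n IH]; first by rewrite mul0r addr0 expr0.
rewrite exprS; apply: le_trans (ler_wpM2l (addr_ge0 ler01 h0) IH).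
have -> : (1 + h) * (1 + n%:R * h) = 1 + n.+1%:R * h + n%:R * h ^+ 2.
  by rewrite -natr1; ring.
by rewrite lerDl mulr_ge0 ?exprn_ge0 ?ler0n.
Qed.

(** Bernoulli's inequality for [b^-1] makes its powers exceed [e^-1]. *)
Lemma expr_small (R : realType) (b e : CC R) :
  0 <= b -> b < 1 -> 0 < e -> exists k, b ^+ k <= e.
Proof.
rewrite le_eqVlt => /orP[/eqP <- _ e0|b0 b1 e0].
  by exists 1%N; rewrite expr1 ltW.
have h0 : 0 < b^-1 - 1 by rewrite subr_gt0 invf_gt1.
have [k] := CC_bound R (e^-1 / (b^-1 - 1)).
rewrite ger0_norm ?divr_ge0 ?invr_ge0 ?(ltW e0) ?(ltW h0) // ltr_pdivrMr // => hk.
exists k.+1; rewrite -[e]invrK -[b]invrK exprVn lef_pV2 ?posrE ?exprn_gt0 ?invr_gt0 //.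
have := @bernoulli _ _ k.+1 (ltW h0); rewrite addrCA subrr addr0 => hb.
by apply: le_trans hb; apply: le_trans (ltW hk) _; rewrite lerDr.
Qed.

Lemma exp_dominates_poly (R : realType) (s t : CC R) n : 0 <= s -> s < t ->
  ~ (forall k : nat, t ^+ k <= k.+1%:R ^+ n * s ^+ k).
Proof.
rewrite le_eqVlt => /orP[/eqP <- t0 /(_ 1%N)|s0 st H].
  by rewrite !expr1 mulr0 => /(lt_le_trans t0); rewrite ltxx.
have h0 : 0 < t / s - 1 by rewrite subr_gt0 ltr_pdivlMr // mul1r.
set h := t / s - 1 in h0.
have [l] := CC_bound R (n.+2%:R ^+ n / h ^+ n.+1).
rewrite ger0_norm ?divr_ge0 ?exprn_ge0 ?ler0n ?(ltW h0) // ltr_pdivrMr ?exprn_gt0 //.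
set L := l.+1.
have L0 : 0 < L%:R :> CC R by rewrite ltr0n.
(* The assumed bound is used at [k = L * n.+1], where [k.+1 <= n.+2 * L] because [L] is positive,
   while Bernoulli gives [L * h <= (t / s) ^+ L]. Cancelling [L ^+ n] then contradicts the choice of
   [L]. *)
have H2 : (L%:R * h) ^+ n.+1 <= (n.+2%:R * L%:R) ^+ n.
  apply: (@le_trans _ _ ((t / s) ^+ (L * n.+1))).
    rewrite exprM lerXn2r ?nnegrE ?mulr_ge0 ?exprn_ge0 ?(ltW L0) ?(ltW h0) //.
    - by rewrite divr_ge0 // ltW // (lt_trans s0).
    - have := @bernoulli _ _ L (ltW h0); rewrite addrCA subrr addr0.
      by apply: le_trans; rewrite lerDr.
  rewrite expr_div_n ler_pdivrMr ?exprn_gt0 //; apply: le_trans (H _) _.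
  rewrite ler_pM2r ?exprn_gt0 // lerXn2r ?nnegrE ?mulr_ge0 ?ler0n //.
  by rewrite -natrM ler_nat (mulSn n.+1) mulnC -add1n leq_add2r.
move: H2; rewrite !exprMn exprS mulrAC ler_pM2r ?exprn_gt0 //.
by move=> /le_lt_trans h1 /h1; rewrite ltxx.
Qed.

(** Equality in the triangle inequality would force [1] and [u] to have the same direction, hence to
    coincide. *)
Lemma norm1D_lt2 (C : numClosedFieldType) (u : C) : `|u| = 1 -> u != 1 -> `|1 + u| < 2.
Proof.
move=> u1 uN1; rewrite lt_neqAle; apply/andP; split; last first.
  by rewrite (le_trans (ler_normD _ _)) // normr1 u1 -mulr2n.
apply: contra uN1 => /eqP e.
have [|t _ [e1 e2]] := @normCDeq _ 1 u; first by rewrite e normr1 u1 -mulr2n.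
by move: e1 e2; rewrite normr1 u1 !mul1r => <- ->.
Qed.

(** * Fourier coefficients and the sup norm *)

Section CoefficientBound.
Context {R : realType} {G : zmodType} {I : finType}.
Variables (chi : I -> G -> CC R).
Hypothesis chi1 : forall i x, `|chi i x| = 1.
Hypothesis chiD : forall i x y, chi i (x + y) = chi i x * chi i y.

Let trig_le (B : CC R) (a : I -> CC R) := forall x, `|\sum_i a i * chi i x| <= B.

(* One step replaces f by y |-> (f y + f (y + x) / chi i0 x) / 2, where x separates chi i0 from a
   given chi j; iterating makes the coefficient of chi j arbitrarily small. *)
Lemma damping (i0 : I) (e : CC R) (s : seq I) : 0 < e ->
  exists w : I -> CC R,
    [/\ forall i, chi i = chi i0 -> w i = 1,
        forall i, `|w i| <= 1,
        forall i, i \in s -> chi i <> chi i0 -> `|w i| <= e &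
        forall B a, trig_le B a -> trig_le B (fun i => a i * w i)].
Proof.
move=> e0; elim: s => [|j s [w [w1 wle1 wle wB]]].
  exists (fun=> 1); split=> // [i|B a aB x]; first by rewrite normr1.
  by under eq_bigr do rewrite mulr1; exact: aB.
have [ej|nj] := pselect (chi j = chi i0).
  exists w; split=> // i; rewrite inE => /orP[/eqP -> //|]; exact: wle.
have [x xj] : exists x, chi j x != chi i0 x.
  apply: contrapT => /forallNP h; apply: nj; apply/funext => x.
  by apply/eqP/negPn/negP; exact: h.
have u0 : chi i0 x != 0 by rewrite -normr_eq0 chi1 oner_eq0.
pose v i := (1 + chi i x / chi i0 x) / 2.
have n1 i : `|chi i x / chi i0 x| = 1 by rewrite normrM normfV !chi1 divr1.
have vle i : `|v i| <= 1.
  rewrite normrM normfV normr_nat ler_pdivrMr ?ltr0n // mul1r.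
  by rewrite (le_trans (ler_normD _ _)) // normr1 n1 -mulr2n.
have vB B a : trig_le B a -> trig_le B (fun i => a i * v i).
  move=> aB y.
  have -> : \sum_i a i * v i * chi i y =
     (\sum_i a i * chi i y + (\sum_i a i * chi i (x + y)) / chi i0 x) / 2.
    rewrite [in RHS]mulr_suml -big_split /= mulr_suml; apply: eq_bigr => i _.
    by rewrite chiD /v mulrA mulrAC mulrDr mulr1 mulrDl !mulrA [a i * _ / _ * _]mulrAC.
  rewrite normrM normfV normr_nat ler_pdivrMr ?ltr0n //.
  rewrite (le_trans (ler_normD _ _)) // normrM normfV chi1 invr1 mulr1.
  by rewrite mulr_natr mulr2n lerD // aB.
have [k hk] : exists k, `|v j| ^+ k <= e.
  apply: expr_small => //.
  rewrite normrM normfV normr_nat ltr_pdivrMr ?ltr0n // mul1r norm1D_lt2 //.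
  by apply: contra xj => /eqP h; rewrite -[chi j x](divfK u0) h mul1r.
(* Bounds already obtained on [s] survive, since [v i] has norm at most 1. *)
exists (fun i => w i * v i ^+ k); split.
- move=> i ei; rewrite w1 // /v ei divff //.
  by rewrite -mulr2n divff ?pnatr_eq0 // expr1n mulr1.
- by move=> i; rewrite normrM normrX mulr_ile1 ?exprn_ile1 ?exprn_ge0.
- move=> i; rewrite inE => /orP[/eqP -> _|si ni].
    by rewrite normrM normrX (le_trans (ler_piMl _ (wle1 _))) ?exprn_ge0.
  rewrite normrM normrX (le_trans (ler_piMr _ _)) ?exprn_ile1 //; exact: wle.
- move=> B a /wB; elim: k {hk} => [|k IH] h.
    by move=> y; under eq_bigr do rewrite expr0 mulr1; exact: h.
  move=> y; have := vB _ _ (IH h) y; congr (`|_| <= _).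
  by apply: eq_bigr => i _; rewrite exprSr !mulrA.
Qed.

(** The family [chi] may repeat a character, so a Fourier coefficient is a sum over a class of
    indices. Damping leaves this class intact and makes the other terms negligible; evaluation at
    [0], where all characters are 1, then isolates it. *)
Lemma norm_coef_le (B : CC R) (a : I -> CC R) (i0 : I) : trig_le B a ->
  `|\sum_(i | `[< chi i = chi i0 >]) a i| <= B.
Proof.
move=> aB; apply/ler_addgt0Pr => e e0.
pose S := \sum_i `|a i|.
have S0 : 0 <= S by apply: sumr_ge0.
(* The terms outside the class then add up to at most [S * (e / (S + 1)) <= e]; the [+ 1] covers the
   case [S = 0]. *)
have d0 : 0 < e / (S + 1) by rewrite divr_gt0 // ltr_wpDl.
have [w [w1 wle1 wle wB]] := @damping i0 _ (index_enum I) d0.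
have := wB _ _ aB 0.
have chi00 i : chi i 0 = 1.
  have /eqP := chiD i 0 0; rewrite addr0 -[X in X == _]mulr1 eq_sym.
  rewrite (inj_eq (mulfI _)); first by move/eqP.
  by rewrite -normr_eq0 chi1 oner_eq0.
under eq_bigr do rewrite chi00 mulr1.
rewrite (bigID (fun i => `[< chi i = chi i0 >])) /=.
set T := \sum_(i | ~~ _) _ => h.
have -> : \sum_(i | `[< chi i = chi i0 >]) a i =
    (\sum_(i | `[< chi i = chi i0 >]) a i * w i + T) - T.
  by rewrite addrK; apply: eq_bigr => i /asboolP /w1 ->; rewrite mulr1.
apply: (le_trans (ler_normB _ _)); apply: lerD => //.
apply: (@le_trans _ _ (S * (e / (S + 1)))).
  rewrite mulr_suml [leRHS](bigID (fun i => `[< chi i = chi i0 >])) /=.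
  apply: (le_trans (ler_norm_sum _ _ _)).
  rewrite ler_wpDl ?sumr_ge0 // => [i _|]; first by rewrite mulr_ge0 // ltW.
  apply: ler_sum => i /asboolPn ni; rewrite normrM ler_wpM2l //.
  by apply: wle; rewrite ?mem_index_enum.
rewrite mulrCA ler_piMr ?(ltW e0) // ler_pdivrMr ?ltr_wpDl // mul1r.
by rewrite lerDl.
Qed.

End CoefficientBound.

(** * Primitive roots of unity *)

Lemma exists_prim_root (C : numClosedFieldType) N : (0 < N)%N ->
  exists z : C, N.-primitive_root z.
Proof.
move=> N0; have [rs] := closed_field_poly_normal ('X^N - 1 : {poly C}).
rewrite (monicP (monicXnsubC 1 N0)) scale1r => e.
have sz : size rs = N.
  by apply/eqP; rewrite -eqSS -(size_prod_XsubC rs id) -e size_XnsubC.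
(* In characteristic 0 the polynomial ['X^N - 1] is separable, so its [N] roots are distinct, and a
   finite group of roots of unity is cyclic. *)
have : has N.-primitive_root rs.
  apply: has_prim_root => //; last by rewrite sz.
    by apply/allP => z; rewrite -root_prod_XsubC -e.
  by rewrite -separable_prod_XsubC -e separable_Xn_sub_1 // pnatr_eq0 -lt0n.
by case/hasP => z _; exists z.
Qed.

Lemma prim_root_exprz (F : fieldType) N (z : F) (m : int) : N.-primitive_root z ->
  (z ^ m == 1) = (N%:Z %| m)%Z.
Proof.
move=> pz; case: m => n; first by rewrite -exprnP dvdzE /= (prim_order_dvd pz).
by rewrite NegzE -invr_expz -exprnP invr_eq1 dvdzE abszN /= (prim_order_dvd pz).
Qed.

(** * Kronecker's theorem for finitely many characters *)

Section Kernel.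
Context {R : realType} {G : zmodType} {n : nat}.
Variables (gamma : 'I_n -> G -> CC R) (z : 'I_n -> CC R).
Hypothesis gamma1 : forall i x, `|gamma i x| = 1.
Hypothesis gammaD : forall i x y, gamma i (x + y) = gamma i x * gamma i y.
Hypothesis z1 : forall i, `|z i| = 1.
Hypothesis gamma_z : forall m m' : 'I_n -> nat,
  (forall x, \prod_i gamma i x ^+ m i = \prod_i gamma i x ^+ m' i) ->
  \prod_i z i ^+ m i = \prod_i z i ^+ m' i.

(* Expanding F ^+ k, where F is the product below, monomials that agree as characters carry
   coefficients of the same argument, so no cancellation occurs: each of the (k + 1) ^ n nonnegative
   coefficients, whose sum is 2 ^ (n k), is at most s ^ k. *)
Lemma kernel_sup (s : CC R) : 0 <= s ->
  (forall x, `|\prod_i (1 + gamma i x / z i)| <= s) -> 2 ^+ n <= s.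
Proof.
move=> s0 Fs; rewrite real_leNgt ?realX ?realn ?ger0_real //; apply/negP => s2.
apply: (@exp_dominates_poly R s (2 ^+ n) n s0 s2) => k.
pose c (m : {ffun 'I_n -> 'I_k.+1}) : CC R := \prod_i 'C(k, m i)%:R.
pose chi (m : {ffun 'I_n -> 'I_k.+1}) x := \prod_i gamma i x ^+ m i.
pose a m := c m / \prod_i z i ^+ m i.
have c0 m : 0 <= c m by apply: prodr_ge0 => i _; rewrite ler0n.
have chi1 m x : `|chi m x| = 1.
  by rewrite normr_prod big1 // => i _; rewrite normrX gamma1 expr1n.
have chiD m x y : chi m (x + y) = chi m x * chi m y.
  by rewrite -big_split; apply: eq_bigr => i _; rewrite gammaD exprMn.
have aB x : `|\sum_m a m * chi m x| <= s ^+ k.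
  have -> : \sum_m a m * chi m x = (\prod_i (1 + gamma i x / z i)) ^+ k.
    rewrite -prodrXl; under [RHS]eq_bigr do rewrite exprDn.
    rewrite bigA_distr_bigA; apply: eq_bigr => m _.
    rewrite /a /c /chi -prodf_div -big_split; apply: eq_bigr => i _ /=.
    by rewrite expr1n mul1r expr_div_n -[RHS]mulr_natl mulrA mulrAC.
  by rewrite normrX lerXn2r ?nnegrE.
have cs m : c m <= s ^+ k.
  apply: le_trans (@norm_coef_le _ _ _ chi chi1 chiD _ _ m aB).
  have -> : \sum_(i | `[< chi i = chi m >]) a i =
      (\sum_(i | `[< chi i = chi m >]) c i) / \prod_i z i ^+ m i.
    rewrite mulr_suml; apply: eq_bigr => i /asboolP e; congr (_ / _).
    by apply: (gamma_z (fun j => i j) (fun j => m j)) => x; move/funeqP: e; exact.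
  rewrite normrM normfV normr_prod [X in _ / X]big1 ?divr1 => [|i _]; last first.
    by rewrite normrX z1 expr1n.
  rewrite ger0_norm ?sumr_ge0 // (bigD1 m) /= ?lerDl ?sumr_ge0 //.
  exact/asboolP.
have -> : (2 ^+ n) ^+ k = \sum_m c m.
  rewrite /c -(bigA_distr_bigA (fun (_ : 'I_n) (j : 'I_k.+1) => 'C(k, j)%:R)).
  rewrite prodr_const card_ord exprAC -natr_sum -natrX (expnDn 1 1 k).
  by congr (_%:R ^+ n); apply: eq_bigr => i _; rewrite !exp1n !muln1.
apply: le_trans (ler_sum _ (fun m _ => cs m)) _.
by rewrite sumr_const card_ffun !card_ord -natrX mulr_natl.
Qed.

End Kernel.

Lemma attain_finite {R : realType} {G : topologicalZmodType} {n : nat}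
    (gamma : 'I_n -> G -> CC R) (z : 'I_n -> CC R) :
  compact [set: G] -> (forall i, is_character (gamma i)) -> (forall i, `|z i| = 1) ->
  (forall m m' : 'I_n -> nat,
    (forall x, \prod_i gamma i x ^+ m i = \prod_i gamma i x ^+ m' i) ->
    \prod_i z i ^+ m i = \prod_i z i ^+ m' i) ->
  exists x, forall i, gamma i x = z i.
Proof.
move=> Gc ch z1 rel.
have gamma1 i x : `|gamma i x| = 1 by case: (ch i).
have gammaD i x y : gamma i (x + y) = gamma i x * gamma i y by case: (ch i).
have u1 i x : `|gamma i x / z i| = 1 by rewrite normrM normfV gamma1 z1 divr1.
pose F x := \prod_i (1 + gamma i x / z i).
have Fc : continuous F.
  apply: continuous_big => [|i _ x]; first exact: mul_continuous.
  apply: (@cvgD _ (CC R : numFieldType)^o _ _ _ (cst 1) (fun x => gamma i x / z i)).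
    exact: cvg_cst.
  apply: (@cvgM (CC R) _ _ _ (gamma i) (cst (z i)^-1)); last exact: cvg_cst.
  by case: (ch i) => + _ _; exact.
(* The norm on [CC R] is itself complex-valued; its real part is a function into [R], to which the
   extreme value theorem applies. *)
pose f x : R := complex.Re `|F x|.
have fE x : (f x)%:C%C = `|F x| by rewrite RRe_real // normr_real.
have fc : continuous f.
  move=> x; apply/(@pseudometric_normed_Zmodule.cvgrPdist_lt R R^o) => e e0.
  have e0C : 0 < e%:C%C :> CC R by rewrite (@ltcR R 0).
  have /(@pseudometric_normed_Zmodule.cvgrPdist_lt (CC R) (CC R : numFieldType)^o) := Fc x.
  move=> /(_ _ e0C); apply: filterS => y.
  rewrite -ltcR; apply: le_lt_trans.
  apply: le_trans (ler_dist_dist (F x) (F y)).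
  rewrite -!fE -rmorphB; exact: (normc_ge_Re (f x - f y)%:C%C).
have [] := @compact_EVT_max G R f [set: G].
- by exists 0.
- exact: Gc.
- exact: continuous_subspaceT.
move=> c _ cmax; exists c.
have : 2 ^+ n <= `|F c|.
  apply: (kernel_sup gamma z gamma1 gammaD z1 rel) => // x.
  by rewrite -[leLHS]/(`|F x|) -!fE lecR; apply: cmax; exact/mem_set.
move=> + i; rewrite [X in _ <= X -> _]normr_prod => le2.
have zi0 : z i != 0 by rewrite -normr_eq0 z1 oner_eq0.
(* If the value at [i] is missed, the [i]-th factor has norm below 2 and the others at most 2, so
   the product cannot reach [2 ^+ n]. *)
apply/eqP/negPn/negP => ne.
have : gamma i c / z i != 1.
  by apply: contra ne => /eqP h; rewrite -[gamma i c](divfK zi0) h mul1r.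
move=> /(norm1D_lt2 _ _ (u1 i c)) lt2; move: le2; apply/negP.
rewrite -real_ltNge ?realX ?realn ?ger0_real ?prodr_ge0 //.
have -> : 2 ^+ n = 2 * \prod_(j | j != i) 2 :> CC R.
  by rewrite -[RHS](bigD1 i (P := predT)) //= prodr_const card_ord.
rewrite (bigD1 i) //=; apply: (@le_lt_trans _ _ (`|1 + gamma i c / z i| * \prod_(j | j != i) 2)).
  rewrite ler_wpM2l //; apply: ler_prod => j _; rewrite normr_ge0 /=.
  by rewrite (le_trans (ler_normD _ _)) // normr1 u1 -mulr2n.
by rewrite ltr_pM2r // prodr_gt0 // => j _; rewrite ltr0n.
Qed.

(** * Compactness and the two implications *)

Lemma compact_bigcap {T : topologicalType} {I : choiceType} (D : set I) (f : I -> set T) :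
  compact [set: T] -> (forall i, D i -> closed (f i)) -> finI D f ->
  \bigcap_(i in D) f i !=set0.
Proof.
move=> Tc fcl fI.
have [[i Di]|D0] := pselect (exists i, D i); last first.
  have [|x _] := fI fset0; first by move=> i; rewrite in_fset0.
  by exists x => i Di; case: D0; exists i.
(* A cluster point of the filter generated by the finite intersections lies in every closed [f j].
   An index in [D] is what shows that the filter contains the whole space. *)
have [|x [_ xcl]] := Tc _ (finI_filter fI).
  by exists (f i); [exact: finI_from1|].
exists x => j Dj; apply: fcl => // B.
by apply: xcl; exists (f j); [apply: finI_from1|].
Qed.

Lemma expfz_root1 {F : fieldType} (N : nat) (z : F) (d : int) :
  z ^+ N = 1 -> (N%:Z %| d)%Z -> z ^ d = 1.
Proof. by move=> zN /dvdzP[q ->]; rewrite mulrC -exprz_exp -exprnP zN exp1rz. Qed.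

Lemma N_PR_relations (R : realType) (G : topologicalZmodType) (N : nat)
  (E : set (G -> CC R)) : (0 < N)%N -> N_PR N E -> relations_divisible N E.
Proof.
move=> N0 EPR n gamma m inj gE rel i.
have [z pz] := exists_prim_root (CC R) N N0.
have [g _|x hx] := EPR (fun g => if g == gamma i then z else 1).
  by rewrite /Z_N /=; case: ifP => _; rewrite ?expr1n // prim_expr_order.
(* At [x] the relation reduces to [z ^ m i = 1], as injectivity gives every other factor the value
   1. *)
rewrite -(prim_root_exprz _ N z _ pz) -(rel x) (bigD1 i) //= big1 => [|j ji].
  by rewrite mulr1 -hx // eqxx.
by rewrite -hx // (inj_eq inj) (negbTE ji) exp1rz.
Qed.

Lemma relations_N_PR (R : realType) (G : topologicalZmodType) (N : nat)
    (E : set (G -> CC R)) :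
  compact [set: G] -> (0 < N)%N -> E `<=` @dual_group R G ->
  relations_divisible N E -> N_PR N E.
Proof.
move=> Gc N0 Ech rel phi phiN.
have := @compact_bigcap G _ E (fun g => [set x | g x = phi g]) Gc.
case=> [g Eg|D DE|x hx]; last by exists x => g Eg; rewrite hx.
  have [gc _ _] := Ech _ Eg.
  have /(closed_comp (fun x _ => gc x)) : closed [set phi g].
    apply/accessible_closed_set1/hausdorff_accessible.
    exact: (@norm_hausdorff (CC R) (CC R : numFieldType)^o).
  exact.
pose gamma (i : 'I_#|{: D}|) : G -> CC R := val (enum_val i).
have gE i : E (gamma i) by apply/set_mem/DE; exact: valP.
have inj : injective gamma by move=> i j /val_inj /enum_val_inj.
have ch i : is_character (gamma i) := Ech _ (gE i).
have pN i : phi (gamma i) ^+ N = 1 := phiN _ (gE i).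
have p1 i : `|phi (gamma i)| = 1.
  by apply/eqP; rewrite -(pexpr_eq1 N0) // -normrX pN normr1.
have [|x hx] := attain_finite _ _ Gc ch p1.
  move=> m m' e; apply: eq_bigr => i _.
  have p0 : phi (gamma i) != 0 by rewrite -normr_eq0 p1 oner_eq0.
  (* Two equal monomials yield one relation with exponents [m i - m' i]; these are multiples of [N],
     so the [N]-th root of unity [phi (gamma i)] has equal powers [m i] and [m' i]. *)
  have /(expfz_root1 _ _ _ (pN i)) : (N%:Z %| (m i)%:Z - (m' i)%:Z)%Z.
    apply: (rel _ gamma (fun i => (m i)%:Z - (m' i)%:Z)) => // x.
    have g0 j : gamma j x != 0 by rewrite -normr_eq0; case: (ch j) => _ -> _; exact: oner_neq0.
    under eq_bigr do rewrite expfzDr // -invr_expz.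
    rewrite prodf_div e divff //.
    by apply/prodf_neq0 => j _; rewrite expf_neq0.
  rewrite expfzDr // -invr_expz => /divr1_eq; exact.
exists x => g /= gD.
by have := hx (enum_rank [` gD]%fset); rewrite /gamma enum_rankK.
Qed.

Theorem theorem2p4 (R : realType) (G : topologicalZmodType)
    (G_hausdorff : hausdorff_space G) (G_compact : compact [set: G])
    (N : nat) (N_pos : (0 < N)%N)
    (E : set (G -> CC R)) (E_dual : E `<=` @dual_group R G) :
  N_PR N E <-> relations_divisible N E.
Proof. by split; [exact: N_PR_relations|exact: relations_N_PR]. Qed.
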